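(* (i) Let $E\subset F$ be a subobject of the object $F$ of $\mathrm{Bmod}^{\mathfrak s}$. Then the least normal subobject $\overline{\mathrm{Im}}(E)$ of $F$ containing $E$ satisfies $\overline{\mathrm{Im}}(E)=(E^\perp)^\perp$. (ii) Let $\phi:E\to F$ be a morphism in $\mathrm{Bmod}^{\mathfrak s}$. Then the dual of the cokernel of $\phi$ is canonically isomorphic (via the dual of the cokernel map $F\to\mathrm{Coker}(\phi)$) to the kernel of $\phi^*:F^*\to E^*$, i.e. $\mathrm{Coker}(\phi)^*=\mathrm{Ker}(\phi^* )$.
   Context: $\mathbb B=\{0,1\}$ is the Boolean semifield ($1+1=1$). A $\mathbb B$-module is a commutative monoid $(M,+,0)$ with $x+x=x$ for all $x$; morphisms are the monoid homomorphisms. $\mathrm{Bmod}^{\mathfrak s}$ is the category of $\mathbb B$-modules endowed with an involution $\sigma$ (an endomorphism with $\sigma^2=\mathrm{id}$), with morphisms the $\mathbb B$-module morphisms commuting with $\sigma$. A subobject is a $\sigma$-invariant submodule. $M^\sigma$ is the set of fixed points of $\sigma$ in $M$; its elements are called null. For $h:L\to M$, $\mathrm{Ker}(h):=h^{-1}(M^\sigma)$, and $\mathrm{Coker}(h):=M/\!\sim$ (with the quotient map $M\to \mathrm{Coker}(h)$, called the cokernel map), where $b\sim b'$ iff $g(b)=g(b')$ for every object $X$ and every morphism $g:M\to X$ of $\mathrm{Bmod}^{\mathfrak s}$ with $\mathrm{Range}(h)\subset\mathrm{Ker}(g)$. A subobject of $F$ is normal if it is the kernel of some morphism of $\mathrm{Bmod}^{\mathfrak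 s}$ with domain $F$. $\overline{\mathrm{Im}}(E)$ is the kernel of the cokernel map of the inclusion $E\subset F$. $\mathfrak s\mathbb B:=\mathbb B\times\mathbb B$ with involution $(x,y)\mapsto(y,x)$. The dual of $F$ is $F^*:=\mathrm{Hom}_{\mathrm{Bmod}^{\mathfrak s}}(F,\mathfrak s\mathbb B)$ with pointwise addition and involution $f\mapsto\sigma\circ f=f\circ\sigma$; for $\phi:E\to F$, $\phi^*:F^*\to E^*$ is $y\mapsto y\circ\phi$. With $\langle x,y\rangle_\sigma:=y(x)\in\mathfrak s\mathbb B$ for $x\in F$, $y\in F^*$, put $E^\perp:=\{y\in F^*\mid\langle x,y\rangle_\sigma\in(\mathfrak s\mathbb B)^\sigma\ \forall x\in E\}$ for $E\subset F$, and similarly $G^\perp:=\{x\in F\mid\langle x,y\rangle_\sigma\in(\mathfrak s\mathbb B)^\sigma\ \forall y\in G\}$ for $G\subset F^*$. *)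

(* Defs.v *)
From HB Require Import structures.
From mathcomp Require Import all_boot all_algebra.
From mathcomp Require Import boolp classical_sets functions.

Set Implicit Arguments.
Unset Strict Implicit.
Unset Printing Implicit Defensive.

Import GRing.Theory.
Local Open Scope classical_set_scope.
Local Open Scope ring_scope.
Local Open Scope quotient_scope.

(** A module over the Boolean semifield is an idempotent commutative monoid.
    The choice structure carried by [nmodType] is no restriction, since any type
    has one by [gen_eqMixin] and [gen_choiceMixin]. *)

HB.mixin Record Nmodule_isBmodule V & GRing.Nmodule V := {
  addxx : forall x : V, x + x = x
}.

#[short(type="bmodType")]
HB.structure Definition Bmodule := {V of Nmodule_isBmodule V & GRing.Nmodule V}.

HB.mixin Record Bmodule_isSBmodule V & Bmodule V := {
  sigma : V -> V;
  sigma_is_nmod_morphism : nmod_morphism sigma;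
  sigmaK : involutive sigma
}.

#[short(type="sbmodType")]
HB.structure Definition SBmodule := {V of Bmodule_isSBmodule V & Bmodule V}.

HB.instance Definition _ (V : sbmodType) :=
  GRing.isNmodMorphism.Build V V (@sigma V) (@sigma_is_nmod_morphism V).

HB.mixin Record isSigmaEquivariant (U V : sbmodType) (f : U -> V) := {
  sigma_morph : forall x, f (sigma x) = sigma (f x)
}.

HB.structure Definition SBmodHom (U V : sbmodType) :=
  {f of isSigmaEquivariant U V f & @GRing.Additive U V f}.

Notation "{ 'sbmod' U -> V }" := (SBmodHom.type U%type V%type)
  (at level 0, U at level 98, V at level 99, format "{ 'sbmod'  U  ->  V }").

HB.instance Definition _ (V : sbmodType) :=
  isSigmaEquivariant.Build V V (@sigma V) (fun _ => erefl).

Lemma sbmod_hom_ext (U V : sbmodType) (f g : {sbmod U -> V}) : f =1 g -> f = g.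
Proof.
move=> /funext; case: f => f [[f1] [f2]]; case: g => g [[g1] [g2]] /= efg.
by case: g / efg g1 g2 => g1 g2; congr SBmodHom.Pack; congr SBmodHom.Class;
  congr (_ _); apply: Prop_irrelevance.
Qed.

Section CompHom.
Variables (U V W : sbmodType) (g : {sbmod V -> W}) (f : {sbmod U -> V}).

Lemma comp_sigma_morph x : (g \o f) (sigma x) = sigma ((g \o f) x).
Proof. by rewrite /= !sigma_morph. Qed.

HB.instance Definition _ :=
  isSigmaEquivariant.Build U W (g \o f) comp_sigma_morph.

End CompHom.

Definition sbmod_comp (U V W : sbmodType) (g : {sbmod V -> W})
  (f : {sbmod U -> V}) : {sbmod U -> W} := g \o f.

Definition sbmod_iso (U V : sbmodType) (f : {sbmod U -> V}) : Prop :=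
  exists g : {sbmod V -> U}, cancel f g /\ cancel g f.

Definition null_set (M : sbmodType) : set M := [set x | sigma x = x].

Record subobject (F : sbmodType) := Subobject {
  subobj_set :> set F;
  subobj0 : subobj_set 0;
  subobjD : forall x y, subobj_set x -> subobj_set y -> subobj_set (x + y);
  subobj_sigma : forall x, subobj_set x -> subobj_set (sigma x)
}.

Section SubobjectAsObject.
Variables (F : sbmodType) (E : subobject F).

Record subobj_of := SubobjOf {
  subobj_val : F;
  subobj_valP : subobj_val \in subobj_set E
}.

HB.instance Definition _ := [isSub for subobj_val].
HB.instance Definition _ := [Choice of subobj_of by <:].

Lemma subobj_nmod_closed : GRing.nmod_closed (fun x : F => x \in subobj_set E).
Proof.
split=> [|x y]; rewrite !inE; first exact: subobj0.
exact: subobjD.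
Qed.

HB.instance Definition _ :=
  GRing.SubChoice_isSubNmodule.Build F _ subobj_of subobj_nmod_closed.

Lemma subobj_addxx (x : subobj_of) : x + x = x.
Proof. by apply: val_inj; rewrite raddfD addxx. Qed.

HB.instance Definition _ := Nmodule_isBmodule.Build subobj_of subobj_addxx.

Lemma subobj_sigma_subproof (x : subobj_of) :
  sigma (val x) \in subobj_set E.
Proof. by apply/mem_set/subobj_sigma/set_mem/valP. Qed.

Definition sub_sigma (x : subobj_of) : subobj_of :=
  SubobjOf (subobj_sigma_subproof x).

Lemma sub_sigma_nmod_morphism : nmod_morphism sub_sigma.
Proof.
by split=> [|x y]; apply: val_inj; [exact: raddf0 | exact: raddfD].
Qed.

Lemma sub_sigmaK : involutive sub_sigma.
Proof. by move=> x; apply: val_inj; apply: sigmaK. Qed.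

HB.instance Definition _ :=
  Bmodule_isSBmodule.Build subobj_of sub_sigma_nmod_morphism sub_sigmaK.

Lemma subobj_val_sigma_morph (x : subobj_of) :
  subobj_val (sigma x) = sigma (subobj_val x).
Proof. by []. Qed.

HB.instance Definition _ :=
  GRing.isNmodMorphism.Build subobj_of F subobj_val (raddf0 val, @raddfD _ _ val).
HB.instance Definition _ :=
  isSigmaEquivariant.Build subobj_of F subobj_val subobj_val_sigma_morph.

Definition subobj_incl : {sbmod subobj_of -> F} := subobj_val.

End SubobjectAsObject.

Section Kernel.
Variables (L M : sbmodType) (h : {sbmod L -> M}).

Definition ker_set : set L := h @^-1` (@null_set M).

Lemma ker_set0 : ker_set 0.
Proof. by rewrite /ker_set /null_set /preimage/= (raddf0 h) (raddf0 (@sigma M)). Qed.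

Lemma ker_setD x y : ker_set x -> ker_set y -> ker_set (x + y).
Proof.
rewrite /ker_set /null_set /preimage/= => hx hy.
by rewrite (raddfD h) (raddfD (@sigma M)) /= hx hy.
Qed.

Lemma ker_set_sigma x : ker_set x -> ker_set (sigma x).
Proof. by rewrite /ker_set /null_set /preimage/= sigma_morph => hx; rewrite !hx. Qed.

Definition Ker : subobject L := Subobject ker_set0 ker_setD ker_set_sigma.

End Kernel.

Section Cokernel.
Variables (L M : sbmodType) (h : {sbmod L -> M}).

Definition coker_rel (b b' : M) : Prop :=
  forall (X : sbmodType) (g : {sbmod M -> X}),
    range h `<=` Ker g -> g b = g b'.

Definition coker_eq : rel M := fun b b' => `[< coker_rel b b' >].

Lemma coker_eq_refl : reflexive coker_eq.
Proof. by move=> b; apply/asboolP. Qed.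

Lemma coker_eq_sym : symmetric coker_eq.
Proof.
by move=> b b'; apply/asboolP/asboolP => H X g /H ->.
Qed.

Lemma coker_eq_trans : transitive coker_eq.
Proof.
by move=> b a c /asboolP ab /asboolP bc; apply/asboolP => X g hg;
  rewrite (ab X g hg) (bc X g hg).
Qed.

Canonical coker_equiv : equiv_rel M :=
  EquivRel coker_eq coker_eq_refl coker_eq_sym coker_eq_trans.

Definition Coker := {eq_quot coker_eq}.

HB.instance Definition _ := Choice.on Coker.

Definition coker_pi (b : M) : Coker := \pi_{eq_quot coker_eq} b.
Definition coker_repr (c : Coker) : M := repr (c : {eq_quot coker_eq}).

Lemma coker_reprK c : coker_pi (coker_repr c) = c.
Proof. exact: reprK. Qed.

Lemma coker_piP b b' : coker_pi b = coker_pi b' <-> coker_rel b b'.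
Proof.
split=> [/eqP|H]; first by rewrite /coker_pi eqmodE => /asboolP.
by apply/eqP; rewrite /coker_pi eqmodE; apply/asboolP.
Qed.

Lemma coker_pi_repr b : coker_rel (coker_repr (coker_pi b)) b.
Proof. by apply/coker_piP; rewrite coker_reprK. Qed.

Definition coker_zero : Coker := coker_pi 0.
Definition coker_add (c d : Coker) : Coker :=
  coker_pi (coker_repr c + coker_repr d).
Definition coker_sigma (c : Coker) : Coker := coker_pi (sigma (coker_repr c)).

Lemma coker_piD b b' : coker_pi (b + b') = coker_add (coker_pi b) (coker_pi b').
Proof.
apply/coker_piP => X g hg; rewrite !raddfD /=.
by rewrite !(coker_pi_repr _ hg).
Qed.

Lemma coker_pi_sigma b : coker_pi (sigma b) = coker_sigma (coker_pi b).
Proof.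
by apply/coker_piP => X g hg; rewrite !sigma_morph (coker_pi_repr _ hg).
Qed.

Lemma coker_addA : associative coker_add.
Proof.
move=> a b c; rewrite -(coker_reprK a) -(coker_reprK b) -(coker_reprK c).
by rewrite -!coker_piD addrA.
Qed.

Lemma coker_addC : commutative coker_add.
Proof. by move=> a b; rewrite /coker_add addrC. Qed.

Lemma coker_add0 : left_id coker_zero coker_add.
Proof. by move=> a; rewrite -(coker_reprK a) -coker_piD add0r. Qed.

HB.instance Definition _ :=
  GRing.isNmodule.Build Coker coker_addA coker_addC coker_add0.

Lemma coker_addxx (c : Coker) : c + c = c.
Proof. by rewrite -(coker_reprK c) -[LHS]coker_piD addxx. Qed.

HB.instance Definition _ := Nmodule_isBmodule.Build Coker coker_addxx.

Lemma coker_sigma_nmod_morphism : nmod_morphism coker_sigma.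
Proof.
split=> [|a b]; first by rewrite -[LHS]coker_pi_sigma raddf0.
rewrite -(coker_reprK a) -(coker_reprK b) -[coker_pi _ + _]coker_piD.
by rewrite -!coker_pi_sigma raddfD; apply: coker_piD.
Qed.

Lemma coker_sigmaK : involutive coker_sigma.
Proof. by move=> a; rewrite -(coker_reprK a) -!coker_pi_sigma sigmaK. Qed.

HB.instance Definition _ :=
  Bmodule_isSBmodule.Build Coker coker_sigma_nmod_morphism coker_sigmaK.

Lemma coker_pi_nmod_morphism : nmod_morphism coker_pi.
Proof. by split=> // b b'; apply: coker_piD. Qed.

HB.instance Definition _ :=
  GRing.isNmodMorphism.Build M Coker coker_pi coker_pi_nmod_morphism.

HB.instance Definition _ :=
  isSigmaEquivariant.Build M Coker coker_pi coker_pi_sigma.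

Definition coker_map : {sbmod M -> Coker} := coker_pi.

End Cokernel.

Definition normal_subobj (F : sbmodType) (N : subobject F) : Prop :=
  exists (X : sbmodType) (f : {sbmod F -> X}), N = Ker f :> set F.

Definition im_bar (F : sbmodType) (E : subobject F) : subobject F :=
  Ker (coker_map (subobj_incl E)).

Definition least_normal_containing (F : sbmodType) (E N : subobject F) : Prop :=
  [/\ normal_subobj N, E `<=` N &
      forall N' : subobject F, normal_subobj N' -> E `<=` N' -> N `<=` N'].

(** The alias [boolB] is needed because the canonical addition of [bool] in the
    library is the exclusive or; here 1 + 1 = 1. *)

Definition boolB := bool.
HB.instance Definition _ := Choice.on boolB.
HB.instance Definition _ := GRing.isNmodule.Build boolB orbA orbC orFb.
HB.instance Definition _ := Nmodule_isBmodule.Build boolB orbb.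

Definition sB := (boolB * boolB)%type.
HB.instance Definition _ := GRing.Nmodule.on sB.

Lemma sB_addxx (x : sB) : x + x = x.
Proof. by case: x => a b; congr pair; apply: addxx. Qed.

HB.instance Definition _ := Nmodule_isBmodule.Build sB sB_addxx.

Definition sB_swap (x : sB) : sB := (x.2, x.1).

Lemma sB_swap_nmod_morphism : nmod_morphism sB_swap.
Proof. by []. Qed.

Lemma sB_swapK : involutive sB_swap.
Proof. by case. Qed.

HB.instance Definition _ :=
  Bmodule_isSBmodule.Build sB sB_swap_nmod_morphism sB_swapK.

Section HomObject.
Variables U V : sbmodType.
Implicit Types f g : {sbmod U -> V}.

HB.instance Definition _ := gen_eqMixin {sbmod U -> V}.
HB.instance Definition _ := gen_choiceMixin {sbmod U -> V}.

Lemma hom0_sigma_morph x : (\0 : U -> V) (sigma x) = sigma ((\0 : U -> V) x).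
Proof. by rewrite /= raddf0. Qed.

HB.instance Definition _ :=
  isSigmaEquivariant.Build U V (\0 : U -> V) hom0_sigma_morph.

Lemma homD_sigma_morph f g x : (f \+ g) (sigma x) = sigma ((f \+ g) x).
Proof. by rewrite /= !sigma_morph raddfD. Qed.

HB.instance Definition _ f g :=
  isSigmaEquivariant.Build U V (f \+ g) (homD_sigma_morph f g).

Definition hom_zero : {sbmod U -> V} := \0 : U -> V.
Definition hom_add f g : {sbmod U -> V} := f \+ g.
Definition hom_sigma f : {sbmod U -> V} := sbmod_comp (@sigma V) f.

Lemma hom_addA : associative hom_add.
Proof. by move=> f g k; apply: sbmod_hom_ext => x /=; rewrite addrA. Qed.

Lemma hom_addC : commutative hom_add.
Proof. by move=> f g; apply: sbmod_hom_ext => x /=; rewrite addrC. Qed.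

Lemma hom_add0 : left_id hom_zero hom_add.
Proof. by move=> f; apply: sbmod_hom_ext => x /=; rewrite add0r. Qed.

HB.instance Definition _ :=
  GRing.isNmodule.Build {sbmod U -> V} hom_addA hom_addC hom_add0.

Lemma hom_addxx f : f + f = f.
Proof. by apply: sbmod_hom_ext => x; apply: addxx. Qed.

HB.instance Definition _ := Nmodule_isBmodule.Build {sbmod U -> V} hom_addxx.

Lemma hom_sigma_nmod_morphism : nmod_morphism hom_sigma.
Proof.
split=> [|f g]; apply: sbmod_hom_ext => x; first exact: raddf0.
exact: raddfD.
Qed.

Lemma hom_sigmaK : involutive hom_sigma.
Proof. by move=> f; apply: sbmod_hom_ext => x /=; rewrite sigmaK. Qed.

HB.instance Definition _ :=
  Bmodule_isSBmodule.Build {sbmod U -> V} hom_sigma_nmod_morphism hom_sigmaK.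

End HomObject.

Definition sdual (F : sbmodType) : sbmodType := {sbmod F -> sB}.

Section DualMap.
Variables (E F : sbmodType) (phi : {sbmod E -> F}).

Definition dual_fun (y : {sbmod F -> sB}) : {sbmod E -> sB} := sbmod_comp y phi.

Lemma dual_fun_nmod_morphism : nmod_morphism dual_fun.
Proof. by split=> [|y z]; apply: sbmod_hom_ext. Qed.

Lemma dual_fun_sigma_morph y : dual_fun (sigma y) = sigma (dual_fun y).
Proof. exact: sbmod_hom_ext. Qed.

HB.instance Definition _ := GRing.isNmodMorphism.Build
  {sbmod F -> sB} {sbmod E -> sB} dual_fun dual_fun_nmod_morphism.

HB.instance Definition _ := isSigmaEquivariant.Build
  {sbmod F -> sB} {sbmod E -> sB} dual_fun dual_fun_sigma_morph.

Definition dual_map : {sbmod sdual F -> sdual E} := dual_fun.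

End DualMap.

Definition pairing (F : sbmodType) (x : F) (y : {sbmod F -> sB}) : sB := y x.

Definition perp (F : sbmodType) (E : set F) : set (sdual F) :=
  [set y | forall x, E x -> null_set (pairing x y)].

Definition coperp (F : sbmodType) (G : set (sdual F)) : set F :=
  [set x | forall y, G y -> null_set (pairing x y)].

(* Main.v *)
Require Import Defs.
From HB Require Import structures.
From mathcomp Require Import all_boot all_algebra.
From mathcomp Require Import boolp classical_sets.

(** Both parts rest on the universal property of the cokernel. For (i), it says
    that [x] lies in [im_bar E] iff [g x] is null for every [g] that is null on
    [E], whereas [(E^perp)^perp] only tests the [g] with values in [sB]. The two
    agree because the morphisms to [sB] separate the points of any object: for
    the order [x <= a <-> x + a = a], the characteristic function of
    [~ (x <= a)] is additive, and pairing it with its conjugate under [sigma]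
    gives a morphism to [sB]. For (ii), [y] lies in [Ker phi^*] iff [y] is null
    on the range of [phi], iff [y] factors through the cokernel map. *)

Set Implicit Arguments.
Unset Strict Implicit.
Unset Printing Implicit Defensive.

Import GRing.Theory.
Local Open Scope classical_set_scope.
Local Open Scope ring_scope.

Section NotBelow.
Variables (X : sbmodType) (a : X).

Definition not_below (x : X) : boolB := x + a != a.

Lemma not_below0 : not_below 0 = 0.
Proof. by rewrite /not_below add0r eqxx. Qed.

(** As [x + y] is the join of [x] and [y], it lies below [a] iff both do; negating turns the
    conjunction into the sum of [boolB]. *)
Lemma not_belowD x y : not_below (x + y) = not_below x + not_below y.
Proof.
suff -> : not_below (x + y) = not_below x || not_below y by [].
rewrite /not_below -negb_and; congr (~~ _);
  apply/eqP/andP => [xya|[/eqP xa /eqP ya]].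
  (* Replacing [a] by [x + y + a] lets idempotence absorb the extra [x] or [y]. *)
  by split; apply/eqP; rewrite -{1}xya -{2}xya !addrA ?addxx // [y + x]addrC
    -[x + y + y]addrA addxx.
by rewrite -addrA ya.
Qed.

Definition not_below_pair (x : X) : sB := (not_below x, not_below (sigma x)).

Lemma not_below_pair_nmod_morphism : nmod_morphism not_below_pair.
Proof.
by split=> [|x y]; rewrite /not_below_pair ?(raddf0 sigma) ?(raddfD sigma)
  ?not_below0 ?not_belowD.
Qed.

Lemma not_below_pair_sigma_morph x :
  not_below_pair (sigma x) = sigma (not_below_pair x).
Proof. by rewrite /not_below_pair sigmaK. Qed.

HB.instance Definition _ :=
  GRing.isNmodMorphism.Build X sB not_below_pair not_below_pair_nmod_morphism.
HB.instance Definition _ :=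
  isSigmaEquivariant.Build X sB not_below_pair not_below_pair_sigma_morph.

Definition not_below_hom : {sbmod X -> sB} := not_below_pair.

End NotBelow.

Lemma sB_separates (X : sbmodType) (a b : X) :
  (forall h : {sbmod X -> sB}, h a = h b) -> a = b.
Proof.
have below (c d : X) : (forall h : {sbmod X -> sB}, h c = h d) -> d + c = c.
  (* The first coordinate suffices: it vanishes at [c], hence at [d], so [d] is below [c].
     Exchanging the roles, antisymmetry gives equality. *)
  move=> /(_ (not_below_hom c)) [+ _].
  by rewrite /not_below addxx eqxx => /esym /negbFE /eqP.
by move=> hab; rewrite -(below _ _ hab) addrC (below b a).
Qed.

(** The class of [x] is null iff [coker_rel] relates [sigma x] to [x], and by equivariance
    [g (sigma x) = g x] says that [g x] is null. *)
Lemma Ker_coker_mapP (L M : sbmodType) (h : {sbmod L -> M}) (x : M) :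
  subobj_set (Ker (coker_map h)) x <->
  forall (X : sbmodType) (g : {sbmod M -> X}), range h `<=` Ker g ->
    subobj_set (Ker g) x.
Proof.
split=> [hx X g hg|hx].
  rewrite /= /ker_set /null_set /preimage /= -sigma_morph.
  by move: X g hg; apply/coker_piP; rewrite -[RHS]hx; exact: coker_pi_sigma.
apply: etrans (esym (coker_pi_sigma h x)) _.
by apply/coker_piP => X g /hx; rewrite sigma_morph.
Qed.

Lemma range_subobj_incl (F : sbmodType) (E : subobject F) :
  range (subobj_incl E) = E.
Proof.
apply/seteqP; split=> [_ [x _ <-]|x Ex]; first exact/set_mem/subobj_valP.
by exists (SubobjOf (mem_set Ex)).
Qed.

Lemma im_barP (F : sbmodType) (E : subobject F) (x : F) :
  subobj_set (im_bar E) x <->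
  forall (X : sbmodType) (g : {sbmod F -> X}), E `<=` Ker g ->
    subobj_set (Ker g) x.
Proof. by rewrite -(range_subobj_incl E); exact: Ker_coker_mapP. Qed.

Lemma im_bar_least (F : sbmodType) (E : subobject F) :
  least_normal_containing E (im_bar E).
Proof.
split; first by exists (Coker (subobj_incl E)), (coker_map (subobj_incl E)).
- by move=> x Ex; apply/im_barP => X g; exact.
- by move=> N' [X [f ->]] Ef x /im_barP; exact.
Qed.

Lemma im_bar_coperp_perp (F : sbmodType) (E : subobject F) :
  subobj_set (im_bar E) = coperp (perp E).
Proof.
apply/seteqP; split=> x; first by move=> /im_barP Ex y; exact: Ex.
(* Nullity of [g x] is an equation in [X], so it can be tested after each [h] into [sB]; the
   composite of [h] with [g] lies in [perp E]. *)
move=> Ex; apply/im_barP => X g Eg; apply: sB_separates => h.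
rewrite sigma_morph; apply: (Ex (sbmod_comp h g)) => z /Eg gz.
by rewrite /null_set /pairing /= -sigma_morph gz.
Qed.

Section DualCokernel.
Variables (E F : sbmodType) (phi : {sbmod E -> F}).

Lemma range_Ker_coker_map : range phi `<=` Ker (coker_map phi).
Proof. by move=> x phix; apply/Ker_coker_mapP => X g; exact. Qed.

(** The involution of the dual acts on values, so a morphism is null iff all its values are. *)
Lemma Ker_dual_mapP (y : sdual F) :
  subobj_set (Ker (dual_map phi)) y <-> range phi `<=` Ker y.
Proof.
split=> [yK _ [x _ <-]|yK]; first exact: (congr1 (fun f : sdual E => f x) yK).
by apply: sbmod_hom_ext => x; apply: yK; exists x.
Qed.

Lemma dual_coker_map_in_Ker (y : sdual (Coker phi)) :
  dual_map (coker_map phi) y \in subobj_set (Ker (dual_map phi)).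
Proof.
apply/mem_set/Ker_dual_mapP => x /range_Ker_coker_map xK.
by rewrite /= /ker_set /null_set /preimage /= -sigma_morph xK.
Qed.

Definition dual_coker (y : sdual (Coker phi)) :
  subobj_of (Ker (dual_map phi)) :=
  SubobjOf (dual_coker_map_in_Ker y).

Lemma dual_coker_nmod_morphism : nmod_morphism dual_coker.
Proof.
by split=> [|y z]; apply: val_inj;
  [exact: (raddf0 (dual_map (coker_map phi)))
  |exact: (raddfD (dual_map (coker_map phi)))].
Qed.

Lemma dual_coker_sigma_morph y : dual_coker (sigma y) = sigma (dual_coker y).
Proof. by apply: val_inj; exact: sbmod_hom_ext. Qed.

HB.instance Definition _ := GRing.isNmodMorphism.Build
  (sdual (Coker phi)) (subobj_of (Ker (dual_map phi)))
  dual_coker dual_coker_nmod_morphism.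
HB.instance Definition _ := isSigmaEquivariant.Build
  (sdual (Coker phi)) (subobj_of (Ker (dual_map phi)))
  dual_coker dual_coker_sigma_morph.

Definition dual_coker_hom :
  {sbmod sdual (Coker phi) -> subobj_of (Ker (dual_map phi))} := dual_coker.

End DualCokernel.

Section FactorThroughCokernel.
Variables (E F X : sbmodType) (phi : {sbmod E -> F}) (g : {sbmod F -> X}).
Hypothesis g_null : range phi `<=` Ker g.

Definition coker_factor_fun (c : Coker phi) : X := g (coker_repr c).

(** The choice of representative is harmless: by [g_null], [g] is one of the morphisms quantified
    over in [coker_rel]. *)
Lemma coker_factor_funE x : coker_factor_fun (coker_pi phi x) = g x.
Proof. exact: coker_pi_repr. Qed.

Lemma coker_factor_nmod_morphism : nmod_morphism coker_factor_fun.
Proof.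
(* Zero and sums in [Coker phi] are by definition classes of elements of [F], so the previous lemma
   applies to them. *)
split=> [|c d]; first by rewrite [LHS]coker_factor_funE raddf0.
by rewrite [LHS]coker_factor_funE raddfD.
Qed.

Lemma coker_factor_sigma_morph c :
  coker_factor_fun (sigma c) = sigma (coker_factor_fun c).
Proof. by rewrite [LHS]coker_factor_funE sigma_morph. Qed.

Lemma coker_factor :
  exists k : {sbmod Coker phi -> X}, forall x, k (coker_map phi x) = g x.
Proof.
pose add := GRing.isNmodMorphism.Build (Coker phi) X coker_factor_fun
  coker_factor_nmod_morphism.
pose equ := isSigmaEquivariant.Build (Coker phi) X coker_factor_fun
  coker_factor_sigma_morph.
pose k : {sbmod Coker phi -> X} :=
  HB.pack_for (SBmodHom.type (Coker phi) X) coker_factor_fun add equ.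
by exists k; exact: coker_factor_funE.
Qed.

End FactorThroughCokernel.

Lemma bijective_sbmod_iso (U V : sbmodType) (f : {sbmod U -> V}) :
  injective f -> (forall v, exists u, f u = v) -> sbmod_iso f.
Proof.
move=> f_inj /choice[g fgK].
have g_add : nmod_morphism g.
  by split=> [|u v]; apply: f_inj;
    rewrite fgK ?(raddf0 f) // (raddfD f) /= !fgK.
have g_sigma v : g (sigma v) = sigma (g v).
  by apply: f_inj; rewrite sigma_morph !fgK.
pose add := GRing.isNmodMorphism.Build V U g g_add.
pose equ := isSigmaEquivariant.Build V U g g_sigma.
pose k : {sbmod V -> U} := HB.pack_for (SBmodHom.type V U) g add equ.
by exists k; split=> [u|v]; [apply: f_inj; exact: fgK | exact: fgK].
Qed.

Lemma dual_coker_iso (E F : sbmodType) (phi : {sbmod E -> F}) :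
  sbmod_iso (dual_coker_hom phi).
Proof.
apply: bijective_sbmod_iso => [y z yz|z].
  (* Injectivity: the cokernel map is onto, so precomposing with it loses nothing. *)
  apply: sbmod_hom_ext => c; rewrite -(coker_reprK c).
  exact: (congr1 (fun u => (val u : sdual F) (coker_repr c)) yz).
(* Surjectivity: an element of the kernel is null on [range phi], so it factors through the
   cokernel. *)
have /Ker_dual_mapP/coker_factor[k kE] := set_mem (valP z).
by exists k; apply: val_inj; exact: sbmod_hom_ext.
Qed.

Theorem proposition1p9 :
  (forall (F : sbmodType) (E : subobject F),
     least_normal_containing E (im_bar E) /\
     subobj_set (im_bar E) = coperp (perp E))
  /\
  (forall (E F : sbmodType) (phi : {sbmod E -> F}),
     exists theta : {sbmod sdual (Coker phi) -> subobj_of (Ker (dual_map phi))},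
       sbmod_iso theta /\
       forall y : sdual (Coker phi),
         subobj_incl (Ker (dual_map phi)) (theta y) = dual_map (coker_map phi) y).
Proof.
split=> [F E|E F phi]; first by split;
  [exact: im_bar_least|exact: im_bar_coperp_perp].
by exists (dual_coker_hom phi); split; first exact: dual_coker_iso.
Qed.
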